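(* Let $h>0$ and let $(\mathbf{x}^n)_{n\ge0}$ be a numerical solution of the variational leapfrog integrator, i.e. for all $n\ge1$ $$\mathbf{M}\,\frac{\mathbf{x}^{n+1}-2\mathbf{x}^n+\mathbf{x}^{n-1}}{h^2}=\mathbf{A}'(\mathbf{x}^n)^\top\,\frac{\mathbf{x}^{n+1}-\mathbf{x}^{n-1}}{2h}-\frac{\mathbf{A}(\mathbf{x}^{n+1})-\mathbf{A}(\mathbf{x}^{n-1})}{2h}.$$ Then the method preserves the discrete energy $$H^{n+1/2}:=\gamma^{n+1/2}+\tfrac12\bigl(\phi(x^n)+\phi(x^{n+1})\bigr),$$ that is, $H^{n+1/2}=H^{1/2}$ for all $n$.
   Context: Let the scalar potential $\phi:\mathbb{R}^3\to\mathbb{R}$ and the vector potential $A:\mathbb{R}^3\to\mathbb{R}^3$ be arbitrarily differentiable (and independent of time). Write $\mathbf{x}=(t;x)\in\mathbb{R}\times\mathbb{R}^3$ (column vector), $\mathbf{M}=\mathrm{diag}(-1,1,1,1)$, $\mathbf{A}(\mathbf{x})=(-\phi(x);A(x))\in\mathbb{R}^4$, and let $\mathbf{A}'(\mathbf{x})=\bigl(\partial_j\mathbf{A}_i(\mathbf{x})\bigr)_{i,j=1}^4$ be the derivative matrix with respect to $\mathbf{x}=(t;x)$. For the numerical solution, $\mathbf{x}^n=(t^n;x^n)$ and $\mathbf{u}^{n+1/2}=(\gamma^{n+1/2};u^{n+1/2})=(\mathbf{x}^{n+1}-\mathbf{x}^n)/h$. *)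

(* Defs.v *)
From HB Require Import structures.
From mathcomp Require Import all_boot all_order all_algebra.
From mathcomp Require Import all_classical all_reals all_analysis.

Set Implicit Arguments.
Unset Strict Implicit.
Unset Printing Implicit Defensive.

Import Order.TTheory GRing.Theory Num.Theory.
Import numFieldNormedType.Exports.
Local Open Scope ring_scope.

Definition iter_derive (R : realType) (V W : normedModType R)
    (f : V -> W) (s : seq V) : V -> W :=
  foldr (fun v g => fun p => 'D_v g p) f s.

(* Differentiability of every iterated directional derivative (the junk value
   of 'D_v at a non-derivable point never matters, as shorter sequences are
   covered too). On finite-dimensional spaces this is C^infinity. *)
Definition smooth (R : realType) (V W : normedModType R) (f : V -> W) : Prop :=
  forall (s : seq V) (p : V), differentiable (iter_derive f s) p.

(* The rows of the library's 'J are indexed by the input variables; this is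
   the usual matrix (d_j F_i)_(i, j) for maps between column vectors. *)
Definition deriv_mx (R : realType) (m n : nat)
    (F : 'cV[R]_m.+1 -> 'cV[R]_n.+1) (p : 'cV[R]_m.+1) : 'M[R]_(n.+1, m.+1) :=
  \matrix_(i, j) 'D_(delta_mx j 0) (fun q => F q i 0 : R^o) p.

(* Points of R x R^3 are columns (t; x) in 'cV_(1 + 3). *)
Definition time_part (R : realType) (p : 'cV[R]_(1 + 3)) : R := usubmx p 0 0.

Definition space_part (R : realType) (p : 'cV[R]_(1 + 3)) : 'cV[R]_3 :=
  dsubmx p.

Definition spacetime (R : realType) (t : R) (x : 'cV[R]_3) : 'cV[R]_(1 + 3) :=
  col_mx t%:M x.

Definition minkowski (R : realType) : 'M[R]_(1 + 3) :=
  diag_mx (\row_(i < 1 + 3) if i == 0 then - 1 else 1).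

Definition four_potential (R : realType) (phi : 'cV[R]_3 -> R)
    (A : 'cV[R]_3 -> 'cV[R]_3) (p : 'cV[R]_(1 + 3)) : 'cV[R]_(1 + 3) :=
  spacetime (- phi (space_part p)) (A (space_part p)).

Definition leapfrog_solution (R : realType) (phi : 'cV[R]_3 -> R)
    (A : 'cV[R]_3 -> 'cV[R]_3) (h : R) (x : nat -> 'cV[R]_(1 + 3)) : Prop :=
  let AA := four_potential phi A in
  forall n : nat, (1 <= n)%N ->
    minkowski R *m ((h ^+ 2)^-1 *: (x n.+1 - 2 *: x n + x n.-1)) =
    (deriv_mx AA (x n))^T *m ((2 * h)^-1 *: (x n.+1 - x n.-1))
    - (2 * h)^-1 *: (AA (x n.+1) - AA (x n.-1)).

(* [half_velocity h x n] is u^(n+1/2) = (gamma^(n+1/2); u^(n+1/2)). *)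
Definition half_velocity (R : realType) (h : R) (x : nat -> 'cV[R]_(1 + 3))
    (n : nat) : 'cV[R]_(1 + 3) :=
  h^-1 *: (x n.+1 - x n).

(* [half_energy phi h x n] is H^(n+1/2). *)
Definition half_energy (R : realType) (phi : 'cV[R]_3 -> R) (h : R)
    (x : nat -> 'cV[R]_(1 + 3)) (n : nat) : R :=
  time_part (half_velocity h x n)
  + 2^-1 * (phi (space_part (x n)) + phi (space_part (x n.+1))).

(* Main.v *)
Require Import Defs.
From mathcomp Require Import all_boot all_order all_algebra.
From mathcomp Require Import all_classical all_reals all_analysis.
From mathcomp Require Import ring.
Import Order.TTheory GRing.Theory Num.Theory.
Import numFieldNormedType.Exports.
Local Open Scope ring_scope.

(** The potentials do not depend on time, so the time column of [A'] vanishes.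
    The time component of the scheme therefore reads
    [h (gamma^(n+1/2) - gamma^(n-1/2)) / h^2 = - (phi(x^(n+1)) - phi(x^(n-1))) / (2 h)],
    which says that the discrete energy is the same at [n+1/2] and [n-1/2]. *)

(** The difference quotients of [f] at [p] along [v] are literally those of the constant [f p], so
    they have the same limit. *)
Lemma derive_invariant (R : realType) (V W : normedModType R) (f : V -> W)
    (v p : V) :
  (forall a : R, f (a *: v + p) = f p) -> 'D_v f p = 0.
Proof.
move=> fv; rewrite -(derive_cst (f p) p v) /derive.
suff -> : (fun a : R => a^-1 *: ((f \o shift p) (a *: v) - f p)) =
    (fun a : R => a^-1 *: ((cst (f p) \o shift p) (a *: v) - cst (f p) p)) by [].
by apply/funext => a /=; rewrite fv.
Qed.

Lemma space_part_time_shift (R : realType) (a : R) (p : 'cV[R]_(1 + 3)) :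
  space_part (a *: delta_mx 0 0 + p) = space_part p.
Proof.
apply/colP => i; rewrite !mxE.
(* Space entries sit at [rshift 1 i], whose value is a successor, so [delta_mx 0 0] vanishes
   there. *)
by rewrite -val_eqE /= mulr0 add0r.
Qed.

Lemma deriv_mx_four_potential_time (R : realType) (phi : 'cV[R]_3 -> R)
    (A : 'cV[R]_3 -> 'cV[R]_3) (p : 'cV[R]_(1 + 3)) i :
  deriv_mx (four_potential phi A) p i 0 = 0.
Proof.
rewrite mxE; apply: derive_invariant => a.
by rewrite /four_potential space_part_time_shift.
Qed.

Lemma deriv_mx_four_potential_tr_time (R : realType) (phi : 'cV[R]_3 -> R)
    (A : 'cV[R]_3 -> 'cV[R]_3) (p w : 'cV[R]_(1 + 3)) :
  ((deriv_mx (four_potential phi A) p)^T *m w) 0 0 = 0.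
Proof.
by rewrite mxE big1 // => i _; rewrite mxE deriv_mx_four_potential_time mul0r.
Qed.

Lemma time_partE (R : realType) (p : 'cV[R]_(1 + 3)) : time_part p = p 0 0.
Proof. by rewrite /time_part mxE; congr (p _ _); apply/val_inj. Qed.

Lemma four_potential_time (R : realType) (phi : 'cV[R]_3 -> R)
    (A : 'cV[R]_3 -> 'cV[R]_3) (p : 'cV[R]_(1 + 3)) :
  four_potential phi A p 0 0 = - phi (space_part p).
Proof.
by rewrite -time_partE /time_part /four_potential col_mxKu mxE mulr1n.
Qed.

Lemma leapfrog_time (R : realType) (phi : 'cV[R]_3 -> R)
    (A : 'cV[R]_3 -> 'cV[R]_3) (h : R) (x : nat -> 'cV[R]_(1 + 3)) (n : nat) :
  leapfrog_solution phi A h x ->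
  (h ^+ 2)^-1 * (x n.+2 0 0 - 2 * x n.+1 0 0 + x n 0 0) =
  - ((2 * h)^-1 * (phi (space_part (x n.+2)) - phi (space_part (x n)))).
Proof.
move=> /(_ n.+1 isT) /= /(congr1 (fun M : 'cV[R]_(1 + 3) => M 0 0)).
rewrite /minkowski mul_diag_mx mxE [X in X * _]mxE eqxx mulN1r.
rewrite [RHS]mxE deriv_mx_four_potential_tr_time.
(* With these values in the goal, [!mxE] treats their left-hand sides as it treats the scheme, so
   they still match afterwards. *)
move: (four_potential_time R phi A (x n.+2)) (four_potential_time R phi A (x n)).
rewrite !mxE => -> -> /eqP; rewrite add0r eqr_opp => /eqP ->.
by ring.
Qed.

Theorem theorem5p1 (R : realType) (phi : 'cV[R]_3 -> R)
  (A : 'cV[R]_3 -> 'cV[R]_3) (h : R) (x : nat -> 'cV[R]_(1 + 3)) :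
  smooth (phi : 'cV[R]_3 -> R^o) ->
  smooth A ->
  0 < h ->
  leapfrog_solution phi A h x ->
  forall n : nat, half_energy phi h x n = half_energy phi h x 0.
Proof.
move=> _ _ h_gt0 sol; elim=> [//|n <-].
have h_neq0 : h != 0 by rewrite gt_eqF.
(* The factor [h] turns the second difference over [h ^+ 2] into the increment of gamma, and
   [(2 * h)^-1] into the weight [2^-1] of the energy. *)
have := congr1 ( *%R h) (leapfrog_time R phi A h x n sol).
rewrite /half_energy !time_partE /half_velocity !mxE => E.
(* Replacing the zero by the difference of the two sides of [E] leaves a rational identity in
   [h]. *)
apply/eqP; rewrite -subr_eq0; apply/eqP.
move: E => /eqP; rewrite -subr_eq0 => /eqP <-.
by field.
Qed.
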